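(* Consider the cache-aided packet-erasure broadcast network described in the context. For each $k_\mathrm{w}\in\{0,1,\dots,K_\mathrm{w}\}$ and $M\ge0$ let \[ R_{k_\mathrm{w}}(M):=F\left(\frac{k_\mathrm{w}}{1-\delta_\mathrm{w}}+\frac{K_\mathrm{s}}{1-\delta_\mathrm{s}}\right)^{-1}+\frac{k_\mathrm{w}M}{D}. \] Then for every $M\ge 0$, \[ C(M)\le\min_{k_\mathrm{w}\in\{0,\dots,K_\mathrm{w}\}}R_{k_\mathrm{w}}(M). \]
   Context: Setting (packet-erasure broadcast channel with receiver caches). Let $K_\mathrm{w},K_\mathrm{s}\ge1$ be integers, $K=K_\mathrm{w}+K_\mathrm{s}$, $D\ge K$ an integer, $F$ a positive integer, and $0<\delta_\mathrm{s}\le\delta_\mathrm{w}<1$. The channel is memoryless with input alphabet $\mathcal X=\{0,1\}^F$; receiver $k$ observes $Y_k=x$ with probability $1-\delta_k$ and an erasure symbol $\Delta$ with probability $\delta_k$. Receivers $1,\dots,K_\mathrm{w}$ are weak ($\delta_k=\delta_\mathrm{w}$), receivers $K_\mathrm{w}+1,\dots,K$ are strong ($\delta_k=\delta_\mathrm{s}$). A library of $D$ independent messages $W_1,\dots,W_D$, each uniform on $\{1,\dots,\lfloor 2^{nR}\rfloor\}$. Caching phase (demands unknown): weak receiver $i$ stores $V_i=g_i(W_1,\dots,W_D)\in\{1,\dots,\lfloor2^{nM}\rfloor\}$; strong receivers have no cache. Delivery: an arbitrary demand vector $\mathbf d\in\{1,\dots,D\}^K$ is known to all; transmitter sends $X^n=f_{\mathbf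 d}(W_1,\dots,W_D)$; weak receiver $i$ decodes from $(Y_i^n,V_i)$, strong receiver $j$ from $Y_j^n$, each aiming at $W_{d_k}$. $(R,M)$ is achievable if for every $\epsilon>0$ there exist $n$ and such functions with worst-case (over all demand vectors) probability that some receiver errs $<\epsilon$. $C(M)$ is the supremum of achievable $R$ for memory $M$.
   Formalization: Achievability requires codes at arbitrarily large blocklengths n, not just some n (with n = 1 every R < 1 would be trivially achievable with one message, making the bound false); erasures are taken independent across receivers. *)

(* Defs.v *)
From HB Require Import structures.
From mathcomp Require Import all_boot all_order all_algebra.
From mathcomp Require Import all_classical all_reals all_analysis.
Set Implicit Arguments. Unset Strict Implicit. Unset Printing Implicit Defensive.
Import Order.TTheory GRing.Theory Num.Theory.
Local Open Scope ring_scope.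

Definition packet (F : nat) := {ffun 'I_F -> bool}.
Definition chout (F : nat) := option (packet F).

Definition msg_size (R : realType) (n : nat) (r : R) : nat :=
  Num.truncn (2 `^ (n%:R * r)).

Definition library (D N : nat) := {ffun 'I_D -> 'I_N}.
(* demand vectors; receivers 'I_(Kw+Ks): lshift = weak, rshift = strong *)
Definition demand (Kw Ks D : nat) := {ffun 'I_(Kw + Ks) -> 'I_D}.
(* erasure pattern over n uses: e t k = true iff receiver k erased at t *)
Definition pattern (Kw Ks n : nat) := {ffun 'I_n -> {ffun 'I_(Kw + Ks) -> bool}}.

Record code (Kw Ks D F n N L : nat) := Code {
  cache : 'I_Kw -> library D N -> 'I_L;
  enc   : demand Kw Ks D -> library D N -> {ffun 'I_n -> packet F};
  decw  : demand Kw Ks D -> 'I_Kw -> {ffun 'I_n -> chout F} -> 'I_L -> 'I_N;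
  decs  : demand Kw Ks D -> 'I_Ks -> {ffun 'I_n -> chout F} -> 'I_N }.

Definition observe (Kw Ks F n : nat) (e : pattern Kw Ks n)
  (x : {ffun 'I_n -> packet F}) (k : 'I_(Kw + Ks)) : {ffun 'I_n -> chout F} :=
  [ffun t => if e t k then None else Some (x t)].

Definition erasure_prob (R : realType) (Kw Ks : nat) (dw ds : R)
  (k : 'I_(Kw + Ks)) : R := if (k < Kw)%N then dw else ds.

(* memoryless channel, erasures independent across time and receivers *)
Definition pattern_prob (R : realType) (Kw Ks n : nat) (dw ds : R)
  (e : pattern Kw Ks n) : R :=
  \prod_(t < n) \prod_(k < Kw + Ks)
     (if e t k then @erasure_prob R Kw Ks dw ds k else 1 - @erasure_prob R Kw Ks dw ds k).

Definition some_error (Kw Ks D F n N L : nat) (C : code Kw Ks D F n N L)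
  (d : demand Kw Ks D) (w : library D N) (e : pattern Kw Ks n) : bool :=
  let x := enc C d w in
  [exists i : 'I_Kw,
     decw C d i (observe e x (lshift Ks i)) (cache C i w) != w (d (lshift Ks i))]
  || [exists j : 'I_Ks,
     decs C d j (observe e x (rshift Kw j)) != w (d (rshift Kw j))].

(* probability of error for demand d, messages uniform and independent *)
Definition error_prob (R : realType) (Kw Ks D F n N L : nat) (dw ds : R)
  (C : code Kw Ks D F n N L) (d : demand Kw Ks D) : R :=
  \sum_(w : library D N) \sum_(e : pattern Kw Ks n)
     (#|{: library D N}|%:R)^-1 * pattern_prob dw ds e * (some_error C d w e)%:R.

Definition achievable (R : realType) (Kw Ks D F : nat) (dw ds : R) (r M : R) : Prop :=
  forall eps : R, 0 < eps -> forall n0 : nat, exists n : nat, (n0 <= n)%N /\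
    exists C : code Kw Ks D F n (msg_size n r) (msg_size n M),
      forall d : demand Kw Ks D, error_prob dw ds C d < eps.

Definition capacity (R : realType) (Kw Ks D F : nat) (dw ds : R) (M : R) : \bar R :=
  ereal_sup (EFin @` [set r : R | achievable Kw Ks D F dw ds r M]).

Definition Rkw (R : realType) (Kw Ks D F : nat) (dw ds : R) (kw : nat) (M : R) : R :=
  F%:R / (kw%:R / (1 - dw) + Ks%:R / (1 - ds)) + kw%:R * M / D%:R.

(* Main.v *)
(* Give all weak receivers the joint cache content V of the first kw of them, and
   let X be the channel input.  With messages w_0, w_1, ... demanded in this order,
   put G m = H(w_0, ..., w_(m-1), V).  Fano's inequality and the fact that
   E H(X restricted to the unerased times | U) / (1 - delta) is nondecreasing in
   delta (submodularity of entropy) give, up to o(n),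
     (G (kw + Ks) - G kw) / (1 - ds) + (G kw - G 0) / (1 - dw) <= n F ln 2.
   Summed over the D cyclic shifts of the order of the messages, G becomes
   concave, G D becomes at least D (D ln N), and G 0 at most D (kw n M ln 2);
   since 1 / (1 - ds) <= 1 / (1 - dw), concavity bounds the left-hand side below
   by the slope of the chord from 0 to D. *)
Require Import Defs.
From HB Require Import structures.
From mathcomp Require Import all_boot all_order all_algebra.
From mathcomp Require Import all_classical all_reals all_analysis.
From mathcomp Require Import ring lra.
Import Order.TTheory GRing.Theory Num.Theory.
Local Open Scope ring_scope.

Set Implicit Arguments.
Unset Strict Implicit.
Unset Printing Implicit Defensive.

(** * Entropy of functions of a uniform variable *)

Lemma ln_le_subr1 (R : realType) (x : R) : 0 < x -> ln x <= x - 1.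
Proof.
by move=> x0; have := @le_ln1Dx R (x - 1); rewrite addrCA subrr addr0; apply; lra.
Qed.

(** Indexed by the point [w] and not by the value [f w]: the count is then never zero, and [T] need
    not be finite, so entropies of sequences and tuples make sense directly. *)
Definition fiber (Om : finType) (T : eqType) (f : Om -> T) (w : Om) : nat :=
  #|[pred w' | f w' == f w]|.

Lemma fiber_gt0 (Om : finType) (T : eqType) (f : Om -> T) (w : Om) :
  (0 < fiber f w)%N.
Proof. by apply/card_gt0P; exists w; rewrite inE. Qed.

Lemma fiber_pos (R : realType) (Om : finType) (T : eqType) (f : Om -> T) (w : Om) :
  0 < (fiber f w)%:R :> R.
Proof. by rewrite ltr0n fiber_gt0. Qed.

Lemma fiber_congr (Om : finType) (T : eqType) (f : Om -> T) (w w' : Om) :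
  f w = f w' -> fiber f w = fiber f w'.
Proof. by rewrite /fiber => ->. Qed.

Lemma fiber_sum (R : realType) (Om : finType) (T : eqType) (f : Om -> T) (w : Om) :
  (fiber f w)%:R = \sum_(w' | f w' == f w) 1 :> R.
Proof. by rewrite sumr_const. Qed.

Lemma fiber_leq (Om : finType) (T T' : eqType) (f : Om -> T) (g : Om -> T') :
  (forall w w', g w = g w' -> f w = f w') ->
  forall w, (fiber g w <= fiber f w)%N.
Proof.
move=> gf w; apply/subset_leq_card/fintype.subsetP => w'.
by rewrite !inE => /eqP/gf ->.
Qed.

(* Shannon entropy in nats of the random variable f when w is uniform. *)
Definition ent (R : realType) (Om : finType) (T : eqType) (f : Om -> T) : R :=
  (\sum_w (ln #|Om|%:R - ln (fiber f w)%:R)) / #|Om|%:R.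

Lemma ent_le (R : realType) (Om : finType) (T T' : eqType) (f : Om -> T) (g : Om -> T') :
  (forall w w', g w = g w' -> f w = f w') -> ent R f <= ent R g.
Proof.
move=> gf; rewrite /ent ler_wpM2r ?invr_ge0//; apply: ler_sum => w _.
by rewrite lerB// ler_ln ?posrE ?fiber_pos// ler_nat fiber_leq.
Qed.

Lemma ent_eq (R : realType) (Om : finType) (T T' : eqType) (f : Om -> T) (g : Om -> T') :
  (forall w w', g w = g w' -> f w = f w') ->
  (forall w w', f w = f w' -> g w = g w') -> ent R f = ent R g.
Proof. by move=> gf fg; apply/eqP; rewrite eq_le !ent_le. Qed.

Lemma ent_injective (R : realType) (Om : finType) (T : eqType) (f : Om -> T) :
  injective f -> ent R f = ln #|Om|%:R.
Proof.
move=> inj_f; rewrite /ent.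
rewrite (eq_bigr (fun=> ln #|Om|%:R)) => [|w _]; last first.
  rewrite [fiber f w](_ : _ = 1%N) ?ln1 ?subr0//.
  by rewrite -(card1 w); apply: eq_card => w'; rewrite !inE inj_eq.
rewrite sumr_const -[_ *+ #|_|]mulr_natr.
(* For empty [Om] both sides are zero, because [ln 0 = 0]. *)
have [->|?] := eqVneq (#|Om|%:R : R) 0; last by rewrite mulfK.
by rewrite invr0 mulr0 ln0.
Qed.

(** Nonnegativity of relative entropy: [ln x <= x - 1] is applied to the ratio of [q (f w)] to the
    probability [fiber f w / #|Om|] of the value [f w]. A subprobability [q] is enough. *)
Lemma ent_gibbs (R : realType) (Om T : finType) (f : Om -> T) (q : T -> R) :
  (forall t, 0 <= q t) -> (forall w, 0 < q (f w)) -> \sum_t q t <= 1 ->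
  ent R f <= (\sum_w - ln (q (f w))) / #|Om|%:R.
Proof.
move=> q0 qf0 q1; rewrite /ent ler_wpM2r ?invr_ge0// -subr_le0 -sumrB.
have [Om0|Om0] := posnP #|Om|.
  by rewrite big1// => w _; have := card0_eq Om0 w; rewrite inE.
have Om0R : 0 < #|Om|%:R :> R by rewrite ltr0n.
apply: (@le_trans _ _ (\sum_w (#|Om|%:R * (q (f w) / (fiber f w)%:R) - 1))).
  apply: ler_sum => w _; rewrite opprK.
  have qf : 0 < q (f w) / (fiber f w)%:R by rewrite divr_gt0// fiber_pos.
  apply: le_trans (ln_le_subr1 (mulr_gt0 Om0R qf)).
  rewrite lnM ?posrE// ln_div ?posrE ?fiber_pos//; lra.
rewrite sumrB -mulr_sumr sumr_const subr_le0 ler_piMr//.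
(* Grouped by the value [t] of [f], the terms of an attained [t] add up to [q t], and an unattained
   [t] gives zero. *)
apply: le_trans q1; rewrite (partition_big f predT)//=; apply: ler_sum => t _.
have [w0 /eqP fw0|noneP] := pickP (fun w => f w == t); last by rewrite big_pred0.
rewrite (eq_bigr (fun=> q t / (fiber f w0)%:R)) => [|w /eqP fw]; last first.
  by rewrite fw (@fiber_congr _ _ f w w0)// fw.
rewrite (eq_bigr (fun=> q t / (fiber f w0)%:R * 1)) => [|? _]; last by rewrite mulr1.
rewrite -mulr_sumr -fw0 -fiber_sum divfK//; first by rewrite gt_eqF// fiber_pos.
Qed.

(** Gibbs' inequality with weight [1 / m] on each point of [A]. *)
Lemma ent_card_le (R : realType) (Om T : finType) (f : Om -> T) (m : nat)
  (A : pred T) : (forall w, A (f w)) -> (#|A| <= m)%N -> ent R f <= ln m%:R.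
Proof.
move=> Af Am; have [Om0|Om0] := posnP #|Om|.
  have -> : ent R f = 0 by rewrite /ent Om0 invr0 mulr0.
  by case: (m) => [|k]; [rewrite ln0|rewrite ln_ge0// ler1n].
have m0 : (0 < m)%N.
  have /card_gt0P[w _] := Om0.
  by apply: leq_trans Am; apply/card_gt0P; exists (f w); exact: Af.
have m0R : 0 < m%:R :> R by rewrite ltr0n.
apply: le_trans (@ent_gibbs R Om T f (fun t => if A t then m%:R^-1 else 0) _ _ _) _.
- by move=> t; case: ifP; rewrite ?invr_ge0.
- by move=> w; rewrite Af invr_gt0.
- rewrite -big_mkcond/= sumr_const -[_ *+ _]mulr_natl ler_pdivrMr// mul1r ler_nat.
  exact: Am.
under eq_bigr do rewrite Af lnV// opprK.
by rewrite sumr_const -[_ *+ #|_|]mulr_natr mulfK// pnatr_eq0 -lt0n.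
Qed.

(* If [u] is a function of [f] and of [g], and [v] of the pair, this is
   [I(f ; g | u) >= 0]. *)
Lemma ent_submod (R : realType) (Om : finType) (T1 T2 T3 T4 : eqType)
  (f : Om -> T1) (g : Om -> T2) (u : Om -> T3) (v : Om -> T4) :
  (forall w w', f w = f w' -> u w = u w') ->
  (forall w w', g w = g w' -> u w = u w') ->
  (forall w w', f w = f w' -> g w = g w' -> v w = v w') ->
  ent R v + ent R u <= ent R f + ent R g.
Proof.
move=> fu gu fgv; pose p w := (f w, g w).
have vp : ent R v <= ent R p by apply: ent_le => w w' [/fgv]; apply.
apply: le_trans (lerD vp (lexx _)) _.
rewrite /ent -!mulrDl ler_wpM2r ?invr_ge0// -subr_le0 -!big_split -sumrB /=.
set c := fun (T : eqType) (f : Om -> T) w => (fiber f w)%:R : R.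
(* With the pair [p] in place of [v], [ln y <= y - 1] for the ratio [y] of fiber sizes leaves to
   show that [y] sums to at most [#|Om|]. *)
apply: (@le_trans _ _ (\sum_w (c _ f w * c _ g w * ((c _ p w)^-1 * (c _ u w)^-1) - 1))).
  apply: ler_sum => w _.
  have [f0 g0 p0 u0] : [/\ 0 < c _ f w, 0 < c _ g w, 0 < c _ p w & 0 < c _ u w].
    by split; exact: fiber_pos.
  have y0 : 0 < c _ f w * c _ g w * ((c _ p w)^-1 * (c _ u w)^-1).
    by rewrite !mulr_gt0// invr_gt0.
  apply: le_trans (ln_le_subr1 y0).
  rewrite !lnM ?posrE ?lnV ?posrE ?mulr_gt0 ?invr_gt0//; rewrite /c; lra.
rewrite sumrB subr_le0.
(* The product of the fiber sizes of [f] and [g] at [w] counts the pairs [(w1, w2)] with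
   [f w1 = f w] and [g w2 = g w]. *)
pose F w1 w2 w := ((f w1 == f w) && (g w2 == g w))%:R * ((c _ p w)^-1 * (c _ u w)^-1).
have -> : \sum_w c _ f w * c _ g w * ((c _ p w)^-1 * (c _ u w)^-1) =
    \sum_w1 \sum_w2 \sum_w F w1 w2 w.
  under [RHS]eq_bigr do rewrite exchange_big.
  rewrite exchange_big; apply: eq_bigr => w _; rewrite /F.
  under eq_bigr do rewrite -mulr_suml.
  rewrite -mulr_suml; congr (_ * _); rewrite /c !fiber_sum big_distrlr/=.
  rewrite big_mkcond; apply: eq_bigr => w1 _.
  rewrite [in LHS]big_mkcond -big_mkcondl/=; case: eqP => _ /=.
    rewrite big_mkcond /=; apply: eq_bigr => w2 _; case: eqP; rewrite ?mulr1//.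
  by rewrite big1.
apply: ler_sum => w1 _.
(* For fixed [w1], only [w2] with [u w2 = u w1] contribute, each at most the inverse of the number
   of such [w2]. *)
apply: (@le_trans _ _ (\sum_(w2 | u w2 == u w1) (c _ u w1)^-1 * 1)); last first.
  by rewrite -mulr_sumr -fiber_sum mulVf// gt_eqF// fiber_pos.
rewrite [leRHS]big_mkcond/=; apply: ler_sum => w2 _.
(* If some [w0] matches [w1] under [f] and [w2] under [g], the matching points are exactly the fiber
   of [p] at [w0], and its size cancels. *)
have [w0 /andP[/eqP fw0 /eqP gw0]|none] :=
  pickP (fun w => (f w1 == f w) && (g w2 == g w)); last first.
  rewrite big1; first by case: ifP => // _; rewrite mulr1 invr_ge0.
  by move=> w _; rewrite /F none mul0r.
rewrite (fu _ _ fw0) (gu _ _ gw0) eqxx.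
rewrite (eq_bigr (fun w => (c _ p w0)^-1 * (c _ u w1)^-1 * (p w == p w0)%:R)).
  rewrite -mulr_sumr.
  have -> : \sum_w (p w == p w0)%:R = c _ p w0.
    by rewrite /c fiber_sum [RHS]big_mkcond/=; apply: eq_bigr => w _; case: ifP.
  by rewrite mulrAC mulVf ?mul1r ?mulr1// gt_eqF// fiber_pos.
move=> w _; rewrite /F mulrC fw0 gw0 xpair_eqE [f w == _]eq_sym [g w == _]eq_sym.
case: eqP => [fw|_]; last by rewrite !mulr0.
case: eqP => [gw|_]; last by rewrite !mulr0.
by rewrite /c (@fiber_congr _ _ p w w0) ?(@fiber_congr _ _ u w w1)//; [apply: fu|rewrite /p]; congruence.
Qed.

Lemma ent_ge0 (R : realType) (Om : finType) (T : eqType) (f : Om -> T) :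
  0 <= ent R f.
Proof.
rewrite divr_ge0// sumr_ge0// => w _; rewrite subr_ge0.
have Om0 : (0 < #|Om|)%N by apply/card_gt0P; exists w.
by rewrite ler_ln ?posrE ?fiber_pos ?ltr0n// ler_nat max_card.
Qed.

Lemma ent_pair_le (R : realType) (Om : finType) (T S : eqType) (f : Om -> T)
  (g : Om -> S) : ent R (fun w => (f w, g w)) <= ent R f + ent R g.
Proof.
have := @ent_submod R Om _ _ _ _ f g (fun=> tt) (fun w => (f w, g w)).
move=> /(_ (fun _ _ _ => erefl) (fun _ _ _ => erefl)) H.
apply: le_trans (H _); first by rewrite lerDl ent_ge0.
by move=> w w' -> ->.
Qed.

(** Conditioning on the finer variable [u] does not increase the conditional entropy of [f]; this is
    submodularity. *)
Lemma ent_cond_le (R : realType) (Om : finType) (T S S' : eqType) (f : Om -> T)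
  (g : Om -> S) (u : Om -> S') (c : R) :
  (forall w w', u w = u w' -> g w = g w') ->
  ent R (fun w => (f w, g w)) <= ent R g + c ->
  ent R (fun w => (f w, u w)) <= ent R u + c.
Proof.
move=> ug fg.
have := @ent_submod R Om _ _ _ _ (fun w => (f w, g w)) u g (fun w => (f w, u w)).
move=> /(_ _ ug) H.
suff: ent R (fun w => (f w, u w)) + ent R g <= ent R (fun w => (f w, g w)) + ent R u by lra.
by apply: H => w w' [] // -> _ ->.
Qed.

(** Chain rule in which the earlier [f j] are dropped from each conditioning, which only increases
    the conditional entropies. *)
Lemma ent_chain (R : realType) (Om : finType) (T S : eqType) (f : nat -> Om -> T)
  (u : Om -> S) (c : nat -> R) (k : nat) :
  (forall j, (j < k)%N -> ent R (fun w => (f j w, u w)) <= ent R u + c j) ->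
  ent R (fun w => (mkseq (fun j => f j w) k, u w)) <= ent R u + \sum_(j < k) c j.
Proof.
elim: k => [|k IH] H; first by rewrite big_ord0 addr0; apply: ent_le => w w' ->.
have : ent R (fun w => (mkseq (fun j => f j w) k.+1, u w)) + ent R u <=
    ent R (fun w => (mkseq (fun j => f j w) k, u w)) + ent R (fun w => (f k w, u w)).
  apply: ent_submod => w w'; [by case|by case|].
  by move=> [e1 e2] [e3 _]; rewrite !mkseqS e1 e2 e3.
have := H k (ltnSn k); have := IH (fun j jk => H j (ltnW jk)).
rewrite big_ord_recr/=; lra.
Qed.

(** [Z] reveals [f] only when the decoder errs, so [g] and [Z] together determine [f]. Its entropy
    is bounded by Gibbs' inequality, with mass [1 / 2] on [None] and the other half spread evenly
    over [T]: each [w] costs [ln 2], and an error costs [ln #|T|] more. *)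
Lemma fano (R : realType) (Om T : finType) (S : eqType) (f : Om -> T) (g : Om -> S)
  (dec : S -> T) :
  ent R (fun w => (f w, g w)) <= ent R g +
    (ln 2 + (\sum_w (dec (g w) != f w)%:R) / #|Om|%:R * ln #|T|%:R).
Proof.
pose Z w := if dec (g w) == f w then None else Some (f w).
apply: (@le_trans _ _ (ent R g + ent R Z)).
  apply: le_trans (ent_pair_le R g Z); apply: ent_le => w w' [gg].
  by rewrite /Z gg; do 2![case: eqP => [<-|_]] => // -[->].
rewrite lerD2l.
have [Om0|Om0] := posnP #|Om|.
  by rewrite /ent Om0 invr0 !mulr0 mul0r addr0 ln_ge0// ler1n.
have [w0 _] := card_gt0P Om0.
have T0 : 0 < #|T|%:R :> R by rewrite ltr0n; apply/card_gt0P; exists (f w0).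
have T20 : 0 < 2 * #|T|%:R :> R by rewrite mulr_gt0.
pose q (z : option T) : R := if z is Some _ then (2 * #|T|%:R)^-1 else 2^-1.
have q0 z : 0 < q z by case: z => [t|]; rewrite /= invr_gt0.
apply: le_trans (@ent_gibbs R Om _ Z q _ _ _) _ => //.
- by move=> z; exact: ltW.
- rewrite (bigD1 None)//= (reindex_omap Some id) /=; last by case.
  rewrite (eq_bigl predT) => [|t]; last by rewrite eqxx.
  by rewrite sumr_const -[_ *+ #|_|]mulr_natr invfM mulfVK ?gt_eqF//; lra.
have -> : ln 2 = (\sum_(w : Om) ln 2) / #|Om|%:R :> R.
  by rewrite sumr_const -[_ *+ #|_|]mulr_natr mulfK// pnatr_eq0 -lt0n.
rewrite mulrAC -mulrDl ler_wpM2r ?invr_ge0// mulr_suml -big_split/=.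
apply: ler_sum => w _; rewrite /Z; case: eqP => _ /=.
  by rewrite lnV ?posrE// opprK mul0r addr0.
by rewrite lnV ?posrE// opprK lnM ?posrE// mul1r.
Qed.

(** * Expectation over i.i.d. sequences *)

Definition iidE (R : realType) (B : finType) (mu : B -> R) (n : nat)
  (phi : {ffun 'I_n -> B} -> R) : R :=
  \sum_(e : {ffun 'I_n -> B}) (\prod_(t < n) mu (e t)) * phi e.

Definition ffcons (B : finType) (n : nat) (b : B) (e : {ffun 'I_n -> B}) :
  {ffun 'I_n.+1 -> B} := [ffun i => if unlift ord0 i is Some j then e j else b].

Lemma ffcons0 (B : finType) (n : nat) (b : B) (e : {ffun 'I_n -> B}) :
  ffcons b e ord0 = b.
Proof. by rewrite ffunE unlift_none. Qed.

Lemma ffconsS (B : finType) (n : nat) (b : B) (e : {ffun 'I_n -> B}) (i : 'I_n) :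
  ffcons b e (lift ord0 i) = e i.
Proof. by rewrite ffunE liftK. Qed.

Lemma iidE_recl (R : realType) (B : finType) (mu : B -> R) (n : nat)
  (phi : {ffun 'I_n.+1 -> B} -> R) :
  iidE mu phi = \sum_b mu b * iidE mu (fun e => phi (ffcons b e)).
Proof.
rewrite /iidE (reindex (fun p : B * {ffun 'I_n -> B} => ffcons p.1 p.2)) /=; last first.
  exists (fun e => (e ord0, [ffun i => e (lift ord0 i)])) => [[b e]|e] _ /=.
    by rewrite ffcons0; congr pair; apply/ffunP => i; rewrite ffunE ffconsS.
  by apply/ffunP => i; rewrite ffunE; case: unliftP => [j|] ->; rewrite ?ffunE.
rewrite -(pair_bigA _ (fun b e => (\prod_t mu (ffcons b e t)) * phi (ffcons b e))) /=.
apply: eq_bigr => b _; rewrite mulr_sumr; apply: eq_bigr => e _.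
rewrite big_ord_recl ffcons0 mulrA; congr (_ * _ * _).
by apply: eq_bigr => i _; rewrite ffconsS.
Qed.

Lemma iidE_le (R : realType) (B : finType) (mu : B -> R) (n : nat)
  (phi psi : {ffun 'I_n -> B} -> R) :
  (forall b, 0 <= mu b) -> (forall e, phi e <= psi e) -> iidE mu phi <= iidE mu psi.
Proof.
by move=> mu0 le; apply: ler_sum => e _; rewrite ler_wpM2l// prodr_ge0.
Qed.

Lemma eq_iidE (R : realType) (B : finType) (mu : B -> R) (n : nat)
  (phi psi : {ffun 'I_n -> B} -> R) : phi =1 psi -> iidE mu phi = iidE mu psi.
Proof. by move=> e; apply: eq_bigr => a _; rewrite e. Qed.

Lemma iidED (R : realType) (B : finType) (mu : B -> R) (n : nat)
  (phi psi : {ffun 'I_n -> B} -> R) :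
  iidE mu (fun e => phi e + psi e) = iidE mu phi + iidE mu psi.
Proof. by rewrite /iidE -big_split; apply: eq_bigr => e _; rewrite mulrDr. Qed.

Lemma iidEZ (R : realType) (B : finType) (mu : B -> R) (n : nat)
  (phi : {ffun 'I_n -> B} -> R) (c : R) :
  iidE mu (fun e => c * phi e) = c * iidE mu phi.
Proof. by rewrite /iidE mulr_sumr; apply: eq_bigr => e _; rewrite mulrCA. Qed.

Lemma iidE_sum (R : realType) (B I : finType) (mu : B -> R) (n : nat)
  (phi : I -> {ffun 'I_n -> B} -> R) :
  iidE mu (fun e => \sum_i phi i e) = \sum_i iidE mu (phi i).
Proof. by rewrite /iidE exchange_big; apply: eq_bigr => e _; rewrite mulr_sumr. Qed.

Lemma iidE_cst (R : realType) (B : finType) (mu : B -> R) (n : nat) (c : R) :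
  \sum_b mu b = 1 -> iidE mu (fun _ : {ffun 'I_n -> B} => c) = c.
Proof.
move=> mu1; rewrite /iidE -mulr_suml -(bigA_distr_bigA (fun _ b => mu b)) /=.
by rewrite big1 ?mul1r.
Qed.

(** Serves to pass from the joint erasure pattern to that of one receiver, [h] being evaluation at
    the receiver. The set of sequences with a given image is a product, so its weight factors. *)
Lemma iidE_map (R : realType) (B B' : finType) (mu : B -> R) (h : B -> B') (n : nat)
  (phi : {ffun 'I_n -> B'} -> R) :
  iidE mu (fun e => phi [ffun t => h (e t)]) =
  iidE (fun c => \sum_(b | h b == c) mu b) phi.
Proof.
rewrite /iidE (partition_big (fun e : {ffun 'I_n -> B} => [ffun t => h (e t)]) predT)//=.
apply: eq_bigr => a _.
rewrite (bigA_distr_big_dep (fun t b => h b == a t) (fun _ b => mu b)) mulr_suml.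
apply: eq_big => [e|e /eqP-> //]; apply/eqP/familyP => [<- t|H].
  by rewrite ffunE unfold_in.
by apply/ffunP => t; rewrite ffunE; apply/eqP; exact: H.
Qed.

(** * Monotone and submodular functions of Bernoulli erasures *)

Definition bern (R : realType) (d : R) (b : bool) : R := if b then d else 1 - d.

Lemma bern_ge0 (R : realType) (d : R) (b : bool) : 0 <= d -> d <= 1 -> 0 <= bern d b.
Proof. by move=> d0 d1; case: b => //=; rewrite subr_ge0. Qed.

Lemma sum_bern (R : realType) (d : R) : \sum_b bern d b = 1.
Proof. by rewrite big_bool /=; lra. Qed.

Lemma bernE_recl (R : realType) (d : R) (n : nat) (phi : {ffun 'I_n.+1 -> bool} -> R) :
  iidE (bern d) phi = d * iidE (bern d) (fun e => phi (ffcons true e)) +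
    (1 - d) * iidE (bern d) (fun e => phi (ffcons false e)).
Proof. by rewrite iidE_recl big_bool. Qed.

(** Coordinate by coordinate, a larger [d] moves weight from [false] to [true], where [phi] is
    larger. *)
Lemma bernE_homo (R : realType) (d d' : R) (n : nat) (phi : {ffun 'I_n -> bool} -> R) :
  0 <= d -> d <= d' -> d' <= 1 ->
  (forall a b : {ffun 'I_n -> bool}, (forall t, a t ==> b t) -> phi a <= phi b) ->
  iidE (bern d) phi <= iidE (bern d') phi.
Proof.
move=> d0 dd' d1; elim: n phi => [|n IH] phi mono.
  by apply: ler_sum => e _; rewrite !big_ord0.
rewrite !bernE_recl.
have mono_cons c : forall a b : {ffun 'I_n -> bool}, (forall t, a t ==> b t) ->
    phi (ffcons c a) <= phi (ffcons c b).
  move=> a b ab; apply: mono => t; rewrite !ffunE.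
  by case: unliftP => [j _|_]; rewrite ?implybb.
have IHt := IH _ (mono_cons true); have IHf := IH _ (mono_cons false).
have ft : iidE (bern d') (fun e => phi (ffcons false e)) <=
          iidE (bern d') (fun e => phi (ffcons true e)).
  apply: iidE_le => [b|e]; first by apply: bern_ge0 => //; lra.
  by apply: mono => t; rewrite !ffunE; case: unliftP => [j _|_]; rewrite ?implybb.
nra.
Qed.

(* The chord form, from 0, of the concavity of [p |-> E phi], where each
   coordinate is kept with probability [p = 1 - d]. *)
Lemma bernE_submod (R : realType) (ds dw : R) (n : nat)
  (phi : {ffun 'I_n -> bool} -> R) :
  0 <= ds -> ds <= dw -> dw <= 1 ->
  (forall a b : {ffun 'I_n -> bool}, phi [ffun t => a t || b t] + phi [ffun t => a t && b t]
     <= phi a + phi b) ->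
  (1 - dw) * (iidE (bern ds) phi - phi [ffun=> true]) <=
  (1 - ds) * (iidE (bern dw) phi - phi [ffun=> true]).
Proof.
move=> d0 dd d1; elim: n phi => [|n IH] phi sub.
  have E d : iidE (bern d) phi = phi [ffun=> true].
    rewrite -[RHS](iidE_cst 0 _ (sum_bern d)); apply: eq_iidE => e.
    by congr phi; apply/ffunP => -[].
  by rewrite !E; lra.
rewrite !bernE_recl.
have sub_cons (a b : {ffun 'I_n -> bool}) : phi (ffcons true [ffun t => a t || b t]) +
    phi (ffcons true [ffun t => a t && b t]) <= phi (ffcons true a) + phi (ffcons true b).
  have := sub (ffcons true a) (ffcons true b); congr (phi _ + phi _ <= _);
  by apply/ffunP => t; rewrite !ffunE; case: unliftP => [j _|_]; rewrite ?ffunE.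
have {IH} := IH _ sub_cons.
have -> : ffcons true [ffun=> true] = [ffun=> true] :> {ffun 'I_n.+1 -> bool}.
  by apply/ffunP => t; rewrite !ffunE; case: unliftP => [j _|_]; rewrite ?ffunE.
(* [D] is the gain from revealing the first coordinate. By submodularity it grows with the set of
   other erased coordinates, hence its mean grows with [d]. *)
pose D e := phi (ffcons false e) + -1 * phi (ffcons true e).
have Dhomo : iidE (bern ds) D <= iidE (bern dw) D.
  apply: bernE_homo => // a b ab; rewrite /D.
  have := sub (ffcons true a) (ffcons false b).
  have -> : [ffun t => ffcons true a t || ffcons false b t] = ffcons true b.
    apply/ffunP => t; rewrite !ffunE; case: unliftP => [j _|_] //.
    by have := ab j; case: (a j) (b j) => [] [].
  have -> : [ffun t => ffcons true a t && ffcons false b t] = ffcons false a.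
    apply/ffunP => t; rewrite !ffunE; case: unliftP => [j _|_] //.
    by have := ab j; case: (a j) (b j) => [] [].
  by lra.
rewrite /D !iidED !iidEZ in Dhomo.
set x := phi _.
move: Dhomo; set a := iidE _ _; set b := iidE _ _; set c := iidE _ _; set d := iidE _ _.
move=> H1 H2.
(* The expectation of [phi] at rate [d] is that of its [true] section plus [1 - d] times that of
   [D]; after cross-multiplication the [D] terms carry the same factor on both sides. *)
have : (1 - dw) * (1 - ds) * (a + -1 * b) <= (1 - dw) * (1 - ds) * (c + -1 * d).
  by rewrite ler_wpM2l// mulr_ge0; lra.
lra.
Qed.

(** * Single-receiver erasures and channel outputs *)

Lemma pattern_prob_marginal (R : realType) (Kw Ks n : nat) (dw ds : R)
  (k : 'I_(Kw + Ks)) (phi : {ffun 'I_n -> bool} -> R) :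
  \sum_(e : pattern Kw Ks n) pattern_prob dw ds e * phi [ffun t => e t k] =
  iidE (bern (erasure_prob dw ds k)) phi.
Proof.
pose mu (b : {ffun 'I_(Kw + Ks) -> bool}) :=
  \prod_(j < Kw + Ks) bern (erasure_prob dw ds j) (b j).
rewrite [LHS](iidE_map mu (fun b : {ffun 'I_(Kw + Ks) -> bool} => b k)).
congr (iidE _ phi); apply/funext => c; rewrite /mu.
under eq_bigl => b do rewrite -[_ == _]/(b k == c).
(* The constraint [b k == c] is written as a product over receivers, so that the sum over [b]
   factors; receivers other than [k] contribute [1]. *)
pose G (j : 'I_(Kw + Ks)) b := bern (erasure_prob dw ds j) b * ((j == k) ==> (b == c))%:R.
rewrite big_mkcond (eq_bigr (fun b : {ffun 'I_(Kw + Ks) -> bool} => \prod_j G j (b j))).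
  rewrite -(bigA_distr_bigA G) (bigD1 k)//= [X in _ * X]big1 ?mulr1.
    rewrite /G big_bool eqxx {G}; by case: c => /=; rewrite mulr0 mulr1 ?addr0 ?add0r.
  by move=> j /negPf jk; rewrite /G jk/= !big_bool/=; lra.
move=> b _; rewrite big_split/=; case: ifP => bk.
  by rewrite [X in _ * X]big1 ?mulr1// => j _; case: eqP => // ->; rewrite bk.
by rewrite [X in _ * X](bigD1 k)//= eqxx bk mul0r mulr0.
Qed.

Definition erase (F n : nat) (a : {ffun 'I_n -> bool}) (x : {ffun 'I_n -> packet F}) :
  {ffun 'I_n -> chout F} := [ffun t => if a t then None else Some (x t)].

Lemma observe_erase (Kw Ks F n : nat) (e : pattern Kw Ks n)
  (x : {ffun 'I_n -> packet F}) (k : 'I_(Kw + Ks)) :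
  observe e x k = erase [ffun t => e t k] x.
Proof. by apply/ffunP => t; rewrite !ffunE. Qed.

(** Given [a], an erased use has one possible output and an unerased one [2 ^ F]; the entropy is at
    most the log of the number of output sequences. *)
Lemma ent_erase_le (R : realType) (Om : finType) (F n : nat) (a : {ffun 'I_n -> bool})
  (x : Om -> {ffun 'I_n -> packet F}) :
  ent R (fun w => erase a (x w)) <= \sum_(t < n) (~~ a t)%:R * (F%:R * ln 2).
Proof.
pose A (t : 'I_n) : pred (chout F) := if a t then pred1 None else predC1 None.
have -> : \sum_(t < n) (~~ a t)%:R * (F%:R * ln 2) =
    ln (2 ^ (\sum_(t < n) ~~ a t * F))%N%:R :> R.
  rewrite natrX lnXn// -[_ *+ (\sum_(t < n) _)]mulr_natl natr_sum mulr_suml.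
  by apply: eq_bigr => t _; rewrite natrM mulrA.
apply: (@ent_card_le R Om _ _ _ (mem (family A))) => [w|].
  by apply/familyP => t; rewrite /A ffunE; case: (a t).
rewrite leq_eqVlt; apply/orP; left; apply/eqP.
rewrite -[LHS]/(#|family A|) card_family foldrE big_map big_enum/= expn_sum.
apply: eq_bigr => t _; rewrite /A; case: (a t); first by rewrite card1.
by rewrite cardC1 card_option card_ffun card_bool card_ord mul1n.
Qed.

Lemma bernE_unerased (R : realType) (d c : R) (n : nat) :
  iidE (bern d) (fun a : {ffun 'I_n -> bool} => \sum_(t < n) (~~ a t)%:R * c) =
  n%:R * (1 - d) * c.
Proof.
elim: n => [|n IH].
  rewrite !mul0r -[RHS](iidE_cst 0 0 (sum_bern d)).
  by apply: eq_iidE => a; rewrite big_ord0.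
rewrite bernE_recl.
have E b : iidE (bern d) (fun a : {ffun 'I_n -> bool} =>
      \sum_(t < n.+1) (~~ ffcons b a t)%:R * c) = (~~ b)%:R * c + n%:R * (1 - d) * c.
  rewrite -IH -[X in X + _](iidE_cst n _ (sum_bern d)) -iidED.
  apply: eq_iidE => a; rewrite big_ord_recl ffcons0; congr (_ + _).
  by apply: eq_bigr => t _; rewrite ffconsS.
by rewrite !E/= -natr1; lra.
Qed.

(** Everything passes through [phi a], the entropy of the first [kw] messages, [V] and the outputs
    left by [a]. Weak decoding bounds its mean above at rate [dw], strong decoding bounds it below
    at rate [ds], full erasure gives [G kw], and [bernE_submod] compares the two rates. *)
Lemma erasure_tradeoff (R : realType) (Om : finType) (T M : eqType) (F n kw ks : nat)
  (dw ds c : R) (f : nat -> Om -> M) (V : Om -> T) (x : Om -> {ffun 'I_n -> packet F})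
  (cw cs : nat -> {ffun 'I_n -> bool} -> R) (G : nat -> R) :
  0 <= ds -> ds <= dw -> dw < 1 ->
  (forall j a, (j < kw)%N -> ent R (fun w => (f j w, (V w, erase a (x w)))) <=
     ent R (fun w => (V w, erase a (x w))) + cw j a) ->
  (forall j, (j < kw)%N -> iidE (bern dw) (cw j) <= c) ->
  (forall j a, (j < ks)%N -> ent R (fun w => (f (kw + j)%N w, erase a (x w))) <=
     ent R (fun w => erase a (x w)) + cs j a) ->
  (forall j, (j < ks)%N -> iidE (bern ds) (cs j) <= c) ->
  (forall m, G m = ent R (fun w => (mkseq (fun j => f j w) m, V w))) ->
  (G (kw + ks)%N - G kw) / (1 - ds) + (G kw - G 0%N) / (1 - dw) <=
  n%:R * (F%:R * ln 2) + c * (kw%:R / (1 - dw) + ks%:R / (1 - ds)).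
Proof.
move=> d0 dd d1 weak cwc strong csc GE.
pose phi a := ent R (fun w => ((mkseq (fun j => f j w) kw, V w), erase a (x w))).
have bge d b : 0 <= d -> d < 1 -> 0 <= bern d b by move=> ? ?; apply: bern_ge0 => //; lra.
have Ew : iidE (bern dw) phi <= G 0%N + n%:R * (1 - dw) * (F%:R * ln 2) + kw%:R * c.
  apply: (@le_trans _ _ (iidE (bern dw) (fun a => ent R V +
      \sum_(t < n) (~~ a t)%:R * (F%:R * ln 2) + \sum_(j < kw) cw j a))).
    apply: iidE_le => [b|a]; first by apply: bge => //; lra.
    apply: (@le_trans _ _ (ent R (fun w => (V w, erase a (x w))) + \sum_(j < kw) cw j a)).
      apply: le_trans (ent_chain (fun j jk => weak j a jk)).
      by apply: ent_le => w w' [-> -> ->].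
    by rewrite lerD2r (le_trans (ent_pair_le _ _ _))// lerD2l ent_erase_le.
  rewrite !iidED iidE_cst ?sum_bern// bernE_unerased iidE_sum !lerD//.
    by rewrite GE; apply: ent_le => w w' [->].
  apply: (@le_trans _ _ (\sum_(j < kw) c)); first by apply: ler_sum => j _; exact: cwc.
  by rewrite sumr_const card_ord mulr_natl.
have Es : G (kw + ks)%N <= iidE (bern ds) phi + ks%:R * c.
  rewrite -[leLHS](iidE_cst n _ (sum_bern ds)).
  apply: (@le_trans _ _ (iidE (bern ds) (fun a => phi a + \sum_(j < ks) cs j a))).
    apply: iidE_le => [b|a]; first by apply: bge => //; lra.
    apply: le_trans (@ent_chain R Om _ _ (fun j => f (kw + j)%N) _ (cs ^~ a) ks _).
      rewrite GE; apply: ent_le => w w' [e1 e2 -> _]; congr pair.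
      rewrite /mkseq iotaD !map_cat -/(mkseq _ _) e2 add0n.
      rewrite -[kw]addn0 iotaDl -!map_comp; congr cat.
      exact: e1.
    (* A strong receiver decodes from its output alone; adding [V] and the weak messages to the
       conditioning keeps the bound. *)
    move=> j jk; apply: ent_cond_le (strong j a jk) => w w' [_ _ ->] //.
  rewrite iidED lerD2l iidE_sum.
  apply: (@le_trans _ _ (\sum_(j < ks) c)); first by apply: ler_sum => j _; exact: csc.
  by rewrite sumr_const card_ord mulr_natl.
have phiT : phi [ffun=> true] = G kw.
  rewrite GE; apply: ent_eq => w w' [-> ->] //; congr (_, _, _).
  by apply/ffunP => t; rewrite !ffunE.
(* The outputs left by [a && b] are determined by those of [a] and [b] together, and those left by
   [a || b] by either one. *)
have sub (a b : {ffun 'I_n -> bool}) : phi [ffun t => a t || b t] +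
    phi [ffun t => a t && b t] <= phi a + phi b.
  rewrite addrC; apply: ent_submod => w w'.
  - move=> [-> -> /ffunP e]; congr pair; apply/ffunP => t.
    by have := e t; rewrite !ffunE; case: (a t); case: (b t).
  - move=> [-> -> /ffunP e]; congr pair; apply/ffunP => t.
    by have := e t; rewrite !ffunE; case: (a t); case: (b t).
  - move=> [-> -> /ffunP ea] [/ffunP eb]; congr pair; apply/ffunP => t.
    by have := ea t; have := eb t; rewrite !ffunE; case: (a t); case: (b t).
have := bernE_submod d0 dd (ltW d1) sub; rewrite phiT => H.
have w0 : 0 < 1 - dw by lra.
have s0 : 0 < 1 - ds by lra.
have H1 : (iidE (bern ds) phi - G kw) / (1 - ds) <= (iidE (bern dw) phi - G kw) / (1 - dw).
  by rewrite ler_pdivrMr// mulrAC ler_pdivlMr// mulrC [leRHS]mulrC.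
have H2 : (G (kw + ks)%N - G kw) / (1 - ds) <=
    (iidE (bern ds) phi - G kw) / (1 - ds) + ks%:R * c / (1 - ds).
  by rewrite -mulrDl ler_pM2r ?invr_gt0//; lra.
have H3 : (iidE (bern dw) phi - G kw) / (1 - dw) <=
    (G 0%N - G kw) / (1 - dw) + n%:R * (F%:R * ln 2) + kw%:R * c / (1 - dw).
  rewrite -[X in _ + X + _](mulfK (lt0r_neq0 w0)) -!mulrDl ler_pM2r ?invr_gt0//; lra.
lra.
Qed.

(** * Concavity from cyclic shifts of the messages *)

Lemma concave_seq_ge (R : realType) (g : nat -> R) (D k : nat) :
  (forall m, g m.+2 + g m <= 2 * g m.+1) -> (k <= D)%N ->
  k%:R * (g D - g 0%N) <= D%:R * (g k - g 0%N).
Proof.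
move=> cc kD.
(* By concavity an increment is at most the mean of the earlier ones. *)
have incr m : m%:R * (g m.+1 - g m) <= g m - g 0%N.
  elim: m => [|m IH]; first by rewrite mul0r subrr.
  have := cc m; rewrite -natr1 => cm.
  have m0 : 0 <= m%:R :> R by [].
  nra.
rewrite -(subnK kD); elim: (D - k)%N => [|m IH]; first by rewrite add0n.
rewrite addSn; set p := (m + k)%N in IH *.
have [p0|p0] := posnP p.
  have -> : k = 0%N by apply/eqP; move/eqP: p0; rewrite addn_eq0 => /andP[].
  by rewrite mul0r subrr mulr0.
have p0R : 0 < p%:R :> R by rewrite ltr0n.
rewrite -(ler_pM2l p0R) -natr1.
have := incr p; have : 0 <= k%:R :> R by [].
nra.
Qed.

Definition window (D N : nat) (i : 'I_D) (m : nat) (w : library D N) : seq 'I_N :=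
  mkseq (fun j => w (iter j (@ordS D) i)) m.

Lemma window_rcons (D N : nat) (i : 'I_D) (m : nat) (w : library D N) :
  window i m.+1 w = rcons (window i m w) (w (iter m (@ordS D) i)).
Proof. by rewrite /window mkseqS. Qed.

Lemma window_cons (D N : nat) (i : 'I_D) (m : nat) (w : library D N) :
  window i m.+1 w = w i :: window (ordS i) m w.
Proof.
rewrite /window /mkseq /= -[1%N]addn0 iotaDl -map_comp; congr cons.
by apply: eq_map => j /=; rewrite -iterS iterSr.
Qed.

Lemma iter_ordS (D : nat) (i : 'I_D) (j : nat) : iter j (@ordS D) i = ((i + j) %% D)%N :> nat.
Proof.
elim: j => [|j IH] /=; first by rewrite addn0 modn_small.
by rewrite IH -addn1 modnDml addn1 addnS.
Qed.

Lemma window_inj (D N : nat) (i : 'I_D) : injective (@window D N i D).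
Proof.
move=> w w' ww; apply/ffunP => j.
(* [k] is the number of cyclic steps from [i] to [j]. *)
pose k := ((j + (D - i)) %% D)%N.
have D0 : (0 < D)%N by apply: leq_ltn_trans (ltn_ord i).
have kD : (k < D)%N by rewrite ltn_pmod.
have -> : j = iter k (@ordS D) i.
  apply: val_inj; rewrite /= iter_ordS modnDmr addnCA subnKC ?(ltnW (ltn_ord i))//.
  by rewrite modnDr modn_small.
have := congr1 (fun s => nth (w i) s k) ww.
by rewrite !nth_mkseq.
Qed.

(** The windows of length [m + 1] from [i] and from its successor have a window of length [m + 2] as
    union and share one of length [m]. Submodularity applies for each [i], and summing over all [i]
    makes the starting point irrelevant. *)
Lemma sum_window_ent_concave (R : realType) (D N : nat) (T : eqType)
  (V : library D N -> T) (m : nat) :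
  let g k := \sum_(i < D) ent R (fun w => (window i k w, V w)) in
  (g m.+2 + g m <= 2 * g m.+1 : Prop).
Proof.
move=> g.
have shift k : \sum_(i < D) ent R (fun w => (window i k w, V w)) =
    \sum_(i < D) ent R (fun w => (window (ordS i) k w, V w)).
  by rewrite (reindex_inj (@ordS_inj D)).
rewrite mulr2n mulrDl !mul1r {2 4}/g shift [X in _ <= _ + X]shift -!big_split/=.
apply: ler_sum => i _; apply: ent_submod => w w'.
- by rewrite !window_cons => -[_ -> ->].
- by rewrite !window_rcons => -[/rcons_inj[-> _] ->].
- rewrite !(window_cons i) => /(congr1 (fun y => head (w i) y.1)) /= wi ww.
  have wS : window (ordS i) m.+1 w = window (ordS i) m.+1 w' := congr1 fst ww.
  by rewrite wi wS (congr1 snd ww : V w = V w').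
Qed.

(** * The converse at finite blocklength *)

Lemma error_prob_marginal (R : realType) (Kw Ks D F n N L : nat) (dw ds : R)
  (C : Defs.code Kw Ks D F n N L) (d : demand Kw Ks D) (k : 'I_(Kw + Ks))
  (err : library D N -> {ffun 'I_n -> bool} -> bool) :
  0 <= ds -> ds <= dw -> dw <= 1 ->
  (forall w (e : pattern Kw Ks n), err w [ffun t => e t k] -> some_error C d w e) ->
  iidE (bern (erasure_prob dw ds k))
    (fun a => (\sum_w (err w a)%:R) / #|{: library D N}|%:R) <= error_prob dw ds C d.
Proof.
move=> d0 dd d1 errP; rewrite -pattern_prob_marginal.
rewrite /error_prob exchange_big /=; apply: ler_sum => e _.
rewrite mulrA mulrC mulrA mulr_sumr; apply: ler_sum => w _.
rewrite ler_wpM2l ?ler_nat//.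
  rewrite mulr_ge0 ?invr_ge0// prodr_ge0// => t _; rewrite prodr_ge0// => j _.
  by apply: (@bern_ge0 _ (erasure_prob dw ds j)); rewrite /erasure_prob; case: ifP => _; lra.
by case: (err _ _) (errP w e) => // ->.
Qed.

(** The term [ln 2 + eps * ln N%:R] is the Fano loss of one receiver. *)
Lemma code_bound (R : realType) (Kw Ks D F n N L kw : nat) (dw ds eps : R)
  (C : Defs.code Kw Ks D F n N L) :
  0 <= ds -> ds <= dw -> dw < 1 -> (kw <= Kw)%N -> (kw + Ks <= D)%N ->
  (0 < N)%N -> (0 < L)%N -> (0 < D)%N ->
  (forall d, error_prob dw ds C d <= eps) ->
  (kw%:R / (1 - dw) + Ks%:R / (1 - ds)) * (D%:R * ln N%:R - kw%:R * ln L%:R) <=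
  D%:R * (n%:R * (F%:R * ln 2) +
    (ln 2 + eps * ln N%:R) * (kw%:R / (1 - dw) + Ks%:R / (1 - ds))).
Proof.
move=> d0 dd d1 kwK kwD N0 L0 D0 errC.
pose V (w : library D N) := [ffun j : 'I_kw => cache C (widen_ord kwK j) w].
pose G i m := ent R (fun w : library D N => (window i m w, V w)).
pose g m := \sum_(i < D) G i m.
have lnN : 0 <= ln N%:R :> R by rewrite ln_ge0// ler1n.
have step i : (G i (kw + Ks)%N - G i kw) / (1 - ds) + (G i kw - G i 0%N) / (1 - dw) <=
    n%:R * (F%:R * ln 2) +
    (ln 2 + eps * ln N%:R) * (kw%:R / (1 - dw) + Ks%:R / (1 - ds)).
  (* Strong receiver [j] asks for position [kw + j], so that the strong demands directly follow
     those of the first [kw] weak receivers in the cyclic order from [i]. *)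
  pose dem k := if (k < Kw)%N then k else (k - Kw + kw)%N.
  pose d : demand Kw Ks D := [ffun k : 'I_(Kw + Ks) => iter (dem k) (@ordS D) i].
  pose f j (w : library D N) : 'I_N := w (iter j (@ordS D) i).
  pose x w := enc C d w.
  (* [insub] extends the error events to every natural [j], with no error out of range. *)
  pose ew j w a := if insub j is Some i then
    decw C d i (erase a (x w)) (cache C i w) != f j w else false.
  pose es j w a := if insub j is Some i then
    decs C d i (erase a (x w)) != f (kw + j)%N w else false.
  pose c (err : nat -> library D N -> {ffun 'I_n -> bool} -> bool) j a : R :=
    ln 2 + (\sum_w (err j w a)%:R) / #|{: library D N}|%:R * ln N%:R.
  have Ec dl (k : 'I_(Kw + Ks))
      (err : nat -> library D N -> {ffun 'I_n -> bool} -> bool) j :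
      erasure_prob dw ds k = dl ->
      (forall w (e : pattern Kw Ks n), err j w [ffun t => e t k] -> some_error C d w e) ->
      iidE (bern dl) (c err j) <= ln 2 + eps * ln N%:R.
    move=> <- errP; rewrite iidED iidE_cst ?sum_bern// lerD2l.
    under eq_iidE do rewrite mulrC.
    rewrite iidEZ mulrC ler_wpM2r//; apply: le_trans (errC d).
    by apply: error_prob_marginal; rewrite // ltW.
  apply: (@erasure_tradeoff R _ _ _ F n kw Ks dw ds _ f V x (c ew) (c es)) => //.
  - move=> j a jkw; have jK : (j < Kw)%N := leq_trans jkw kwK.
    pose ij := Ordinal jK.
    (* Fano's inequality uses the receiver's own cache, which is one component of [V]. *)
    apply: (@ent_cond_le _ _ _ _ _ _ (fun w => (erase a (x w), cache C ij w))).
      move=> w w' [/ffunP/(_ (Ordinal jkw)) + ->]; rewrite !ffunE.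
      by rewrite (_ : widen_ord _ _ = ij); [move=> ->|exact: val_inj].
    have := fano R (f j) (fun w => (erase a (x w), cache C ij w))
      (fun y => decw C d ij y.1 y.2).
    rewrite card_ord /c /ew insubT//=.
  - move=> j jkw; have jK : (j < Kw)%N := leq_trans jkw kwK.
    apply: (Ec dw (lshift Ks (Ordinal jK))); first by rewrite /erasure_prob /= jK.
    move=> w e; rewrite /ew insubT/= => ewj; apply/orP; left; apply/existsP.
    exists (Ordinal jK); rewrite observe_erase; move: ewj; congr (_ != _).
    by rewrite /f /d ffunE /dem /= jK.
  - move=> j a jks.
    have := fano R (f (kw + j)%N) (fun w => erase a (x w)) (decs C d (Ordinal jks)).
    by rewrite card_ord /c /es insubT.
  - move=> j jks; apply: (Ec ds (rshift Kw (Ordinal jks))).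
      by rewrite /erasure_prob /= ltnNge leq_addr.
    move=> w e; rewrite /es insubT/= => esj; apply/orP; right; apply/existsP.
    exists (Ordinal jks); rewrite observe_erase; move: esj; congr (_ != _).
    by rewrite /f /d ffunE /dem /= ltnNge leq_addr/= addKn addnC.
have w0 : 0 < 1 - dw by lra.
have s0 : 0 < 1 - ds by lra.
have conc m : (m <= D)%N -> m%:R * (g D - g 0%N) <= D%:R * (g m - g 0%N).
  by apply: concave_seq_ge => k; exact: sum_window_ent_concave.
have c1 := conc _ (leq_trans (leq_addr Ks kw) kwD).
have c2 := conc _ kwD.
have D0R : 0 < D%:R :> R by rewrite ltr0n.
have gD : D%:R * (D%:R * ln N%:R) <= g D.
  rewrite mulr_natl -[X in _ *+ X]card_ord -sumr_const; apply: ler_sum => i _.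
  apply: (@le_trans _ _ (ent R (@window D N i D))); last first.
    by apply: ent_le => w w' [].
  rewrite (ent_injective _ (@window_inj D N i)) card_ffun !card_ord natrX.
  by rewrite lnXn ?ltr0n// mulr_natl.
have g0 : g 0%N <= D%:R * (kw%:R * ln L%:R).
  rewrite mulr_natl -[X in _ *+ X]card_ord -sumr_const; apply: ler_sum => i _.
  apply: (@le_trans _ _ (ent R V)); first by apply: ent_le => w w' ->.
  rewrite mulr_natl -lnXn ?ltr0n// -natrX.
  by apply: (@ent_card_le R _ _ V _ predT) => //; rewrite cardT -cardE card_ffun !card_ord.
have : (g (kw + Ks)%N - g kw) / (1 - ds) + (g kw - g 0%N) / (1 - dw) <=
    D%:R * (n%:R * (F%:R * ln 2) +
    (ln 2 + eps * ln N%:R) * (kw%:R / (1 - dw) + Ks%:R / (1 - ds))).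
  rewrite /g -!sumrB !mulr_suml -big_split/= [leRHS]mulr_natl.
  by rewrite -[X in _ *+ X]card_ord -sumr_const; apply: ler_sum => i _; exact: step.
apply: le_trans.
rewrite -(ler_pM2l D0R).
move: c1 c2 gD g0; rewrite natrD.
set X := g 0%N; set Y := g kw; set Z := g (kw + Ks)%N; set W := g D.
set vw := (1 - dw)^-1; set vs := (1 - ds)^-1.
have vs0 : 0 <= vs by rewrite invr_ge0 ltW.
have vws : 0 <= vw - vs by rewrite subr_ge0 lef_pV2 ?posrE//; lra.
have kw0 : 0 <= kw%:R :> R by []; have Ks0 : 0 <= Ks%:R :> R by [].
move=> c1 c2 gD g0.
(* Summation by parts: [(Z - Y) * vs + (Y - X) * vw] equals [(Z - X) * vs + (Y - X) * (vw - vs)],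
   with nonnegative weights on the two chord inequalities. *)
have {}c1 := ler_wpM2l vws c1.
have {}c2 := ler_wpM2l vs0 c2.
have S0 : 0 <= kw%:R * vw + Ks%:R * vs by rewrite addr_ge0// mulr_ge0//; lra.
have : (kw%:R * vw + Ks%:R * vs) * (D%:R * (D%:R * ln N%:R - kw%:R * ln L%:R)) <=
    (kw%:R * vw + Ks%:R * vs) * (W - X) by apply: ler_wpM2l => //; lra.
lra.
Qed.

(** * Large blocklength *)

Lemma ln_msg_size_le (R : realType) (n : nat) (r : R) :
  0 <= n%:R * r -> ln (msg_size n r)%:R <= n%:R * r * ln 2.
Proof.
move=> nr0; have x0 : 0 < 2 `^ (n%:R * r) :> R by rewrite powR_gt0.
rewrite -ln_powR; have /andP[Nx _] := truncn_itv (ltW x0).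
have [->|N0] := posnP (msg_size n r); last by rewrite ler_ln ?posrE ?ltr0n.
by rewrite ln0// ln_powR mulr_ge0// ln_ge0// ler1n.
Qed.

(** Truncation at most halves a real that is at least [1], a loss of one bit. *)
Lemma ln_msg_size_ge (R : realType) (n : nat) (r : R) :
  0 <= n%:R * r -> (0 < msg_size n r)%N /\
  (n%:R * r - 1) * ln 2 <= ln (msg_size n r)%:R.
Proof.
move=> nr0; have x1 : 1 <= 2 `^ (n%:R * r) :> R.
  by rewrite -[leLHS](powRr0 2) ler_powR// ler1n.
have x0 : 0 < 2 `^ (n%:R * r) :> R by lra.
have /andP[_ xN] := truncn_itv (ltW x0).
have N0 : (0 < msg_size n r)%N.
  rewrite lt0n; apply/eqP => N0; move: xN; rewrite -/(msg_size n r) N0; lra.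
split=> //; have N1 : 1 <= (msg_size n r)%:R :> R by rewrite ler1n.
rewrite mulrBl mul1r lerBlDl -lnM ?posrE ?ltr0n// -ln_powR ler_ln ?posrE//.
  by move: xN; rewrite -/(msg_size n r) -natr1; lra.
by rewrite mulr_gt0// ltr0n.
Qed.

Lemma achievable_le (R : realType) (Kw Ks D F kw : nat) (dw ds r M : R) :
  (0 < Ks)%N -> (Kw + Ks <= D)%N -> 0 <= ds -> ds <= dw -> dw < 1 -> 0 <= M ->
  (kw <= Kw)%N -> achievable Kw Ks D F dw ds r M -> r <= Rkw Kw Ks D F dw ds kw M.
Proof.
move=> Ks0 KD d0 dd d1 M0 kwK ach; rewrite /Rkw.
set S := kw%:R / _ + _; set B := _ + _.
have S0 : 0 < S by rewrite ltr_wpDl ?divr_ge0 ?divr_gt0 ?ltr0n//; lra.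
have D0 : (0 < D)%N by apply: leq_trans KD; rewrite addn_gt0 Ks0 orbT.
have D0R : 0 < D%:R :> R by rewrite ltr0n.
have B0 : 0 <= B by rewrite addr_ge0// divr_ge0// ?mulr_ge0// ltW.
rewrite leNgt; apply/negP => Br.
have r0 : 0 < r by lra.
(* Fano's loss is about [eps * n * r] bits; this [eps] makes it half of the gap [n * (r - B)]. *)
pose eps := (r - B) / (2 * r).
have eps0 : 0 < eps by rewrite divr_gt0//; lra.
have er : eps * r = (r - B) / 2 by rewrite /eps; field; rewrite gt_eqF.
have eps1 : eps <= 1 by rewrite /eps ler_pdivrMr; lra.
(* The remaining half of the gap must exceed two bits: one lost by truncating the message size, one
   from the [ln 2] in Fano's inequality. Hence the [4]. *)
have [n [n0n [C errC]]] := ach _ eps0 (Num.truncn (4 / (r - B))).+1.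
have n4 : 4 < n%:R * (r - B).
  rewrite -ltr_pdivrMr; last by lra.
  by apply: lt_le_trans (truncnS_gt _) _; rewrite ler_nat.
have n0 : 0 <= n%:R :> R by [].
have [N0 lnN] := ln_msg_size_ge (mulr_ge0 n0 (ltW r0)).
have [L0 _] := ln_msg_size_ge (mulr_ge0 n0 M0).
have lnL := ln_msg_size_le (mulr_ge0 n0 M0).
have kwD : (kw + Ks <= D)%N by apply: leq_trans KD; rewrite leq_add2r.
have := code_bound d0 dd d1 kwK kwD N0 L0 D0 (fun d => ltW (errC d)).
rewrite -/S; move: lnN lnL; set l := ln 2; set a := ln (msg_size n r)%:R; set b := ln _.
move=> lnN lnL bound.
have l0 : 0 < l by rewrite ln_gt0// ltr1n.
have kw0 : 0 <= kw%:R :> R by [].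
(* From here on the products are formed by hand, so that the conclusion is linear in the resulting
   monomials. *)
have e1 : (1 - eps) * ((n%:R * r - 1) * l) <= (1 - eps) * a by rewrite ler_wpM2l//; lra.
have e2 : kw%:R * b <= kw%:R * (n%:R * M * l) by rewrite ler_wpM2l.
have BE : D%:R * S * B = D%:R * F%:R + S * kw%:R * M.
  by rewrite /B; field; rewrite !gt_eqF.
suff : D%:R * S * l * (n%:R * (r - B)) <= D%:R * S * l * 4.
  by rewrite ler_pM2l ?mulr_gt0//; lra.
have DS0 : 0 < D%:R * S by rewrite mulr_gt0.
have e3 : D%:R * S * ((1 - eps) * ((n%:R * r - 1) * l)) <= D%:R * S * ((1 - eps) * a).
  by rewrite ler_pM2l.
have e4 : S * (kw%:R * b) <= S * (kw%:R * (n%:R * M * l)) by rewrite ler_pM2l.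
have e5 : n%:R * l * (D%:R * S * B) = n%:R * l * (D%:R * F%:R + S * kw%:R * M).
  by rewrite BE.
have e6 : D%:R * S * l * n%:R * (eps * r) = D%:R * S * l * n%:R * ((r - B) / 2).
  by rewrite er.
have e7 : 0 <= D%:R * S * l * eps by do 2![apply/mulr_ge0; last exact: ltW]; exact: ltW.
lra.
Qed.

Theorem theorem2 (R : realType) (Kw Ks D F : nat) (dw ds : R) (M : R) :
  (1 <= Kw)%N -> (1 <= Ks)%N -> (Kw + Ks <= D)%N -> (1 <= F)%N ->
  0 < ds -> ds <= dw -> dw < 1 -> 0 <= M ->
  (capacity Kw Ks D F dw ds M
     <= \big[Order.min/+oo%E]_(kw < Kw.+1) (Rkw Kw Ks D F dw ds kw M)%:E)%E.
Proof.
move=> _ Ks0 KD _ d0 dd d1 M0.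
apply: ge_ereal_sup => _ [r /= ach <-].
apply: le_bigmin => [|kw _]; first by rewrite leey.
by rewrite lee_fin; apply: achievable_le => //; [exact: ltW|rewrite -ltnS].
Qed.
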